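(* There exists $\varepsilon_0>0$ such that for every real $\varepsilon$ with $0<\varepsilon\le\varepsilon_0$ there is $n_0=n_0(\varepsilon)$ such that for all $n\ge n_0$, $$f(n,1+\varepsilon)\ \ge\ n^{\frac{\varepsilon^2}{250\ln(1/\varepsilon)}}.$$
   Context: All graphs are finite and simple. For a graph $G$, $\Delta(G)$ and $\delta(G)$ denote its maximum and minimum degree, and $G[U]$ denotes the subgraph of $G$ induced on $U\subseteq V(G)$. For a real $c\ge 1$, a graph $G$ is $c$-nearly regular if $\Delta(G)\le c\cdot\delta(G)$. Define $f(G,c)=\max\{|U| : U\subseteq V(G),\ G[U]\text{ is } c\text{-nearly regular}\}$ and $f(n,c)=\min\{f(G,c): |V(G)|=n\}$. *)

(* Defs.v *)
From HB Require Import structures.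
From mathcomp Require Import all_boot all_order all_algebra.
From mathcomp Require Import reals.

Set Implicit Arguments.
Unset Strict Implicit.
Unset Printing Implicit Defensive.

Import Order.TTheory GRing.Theory Num.Theory.

Definition simple (T : finType)
    (e : {ffun T -> {ffun T -> bool}}) : bool :=
  [forall x, ~~ e x x] && [forall x, forall y, e x y == e y x].

(* Adjacency is a finite function, so that the graphs on a given finite vertex
   type form a finite type and one can minimize over them. *)
Record sgraph (T : finType) := SGraph {
  adj : {ffun T -> {ffun T -> bool}};
  adj_simple : simple adj
}.

HB.instance Definition _ (T : finType) := [isSub for @adj T].
HB.instance Definition _ (T : finType) := [Finite of sgraph T by <:].

Definition degree (T : finType) (G : sgraph T) (v : T) : nat :=
  #|[set w | adj G v w]|.

Definition maxdeg (T : finType) (G : sgraph T) : nat :=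
  \max_(v : T) degree G v.

(* Every degree is at most #|T|, so the initial value #|T| is neutral; the
   graph without vertices gets minimum degree 0. *)
Definition mindeg (T : finType) (G : sgraph T) : nat :=
  \big[minn/#|T|]_(v : T) degree G v.

Lemma induced_simple (T : finType) (G : sgraph T) (U : {set T}) :
  simple [ffun x : {x : T | x \in U} =>
           [ffun y : {x : T | x \in U} => adj G (val x) (val y)]].
Proof.
have /andP[/forallP irr /forallP sym] := adj_simple G.
apply/andP; split; apply/forallP => x; first by rewrite !ffunE irr.
by apply/forallP => y; rewrite !ffunE; exact: (forallP (sym (val x))).
Qed.

Definition induced (T : finType) (G : sgraph T) (U : {set T}) :
    sgraph {x : T | x \in U} :=
  SGraph (induced_simple G U).

Definition nearly_regular (R : realType) (c : R) (T : finType)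
    (G : sgraph T) : bool :=
  ((maxdeg G)%:R <= c * (mindeg G)%:R)%R.

Definition f_graph (R : realType) (T : finType) (G : sgraph T) (c : R) : nat :=
  \max_(U : {set T} | nearly_regular c (induced G U)) #|U|.

(* The initial value n is neutral because f_graph G c <= n for all G on n
   vertices; see f_numP. *)
Definition f_num (R : realType) (n : nat) (c : R) : nat :=
  \big[minn/n]_(G : sgraph 'I_n) f_graph G c.

Lemma empty_simple (T : finType) : simple [ffun _ : T => [ffun _ : T => false]].
Proof.
apply/andP; split; apply/forallP => x; first by rewrite !ffunE.
by apply/forallP => y; rewrite !ffunE.
Qed.

Lemma f_graph_le (R : realType) (T : finType) (G : sgraph T) (c : R) :
  f_graph G c <= #|T|.
Proof. by apply/bigmax_leqP => U _; exact: max_card. Qed.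

Lemma f_numP (R : realType) (n : nat) (c : R) :
  (exists G : sgraph 'I_n, f_num n c = f_graph G c) /\
  (forall G : sgraph 'I_n, f_num n c <= f_graph G c).
Proof.
have le_f (G : sgraph 'I_n) : f_num n c <= f_graph G c.
  rewrite /f_num; have: G \in index_enum (sgraph 'I_n) by exact: mem_index_enum.
  elim: (index_enum _) => //= H s IH; rewrite inE big_cons geq_min.
  by case/predU1P => [<-|/IH ->]; rewrite ?leqnn ?orbT.
split=> //.
have [] : f_num n c = n \/ exists G : sgraph 'I_n, f_num n c = f_graph G c.
- rewrite /f_num; elim/big_rec: _ => [|G m _ IH]; first by left.
  by case: (leqP (f_graph G c) m) => _ //; right; exists G.
- move=> eq_n; exists (SGraph (empty_simple 'I_n)); apply/eqP.
  rewrite eqn_leq le_f eq_n /=.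
  by apply: leq_trans (f_graph_le _ _) _; rewrite card_ord.
- by [].
Qed.

(* Main.v *)
(* Put dl = eps^2/100 and let U maximize e(U) / |U|^(2 - dl).  Deleting one vertex
   shows that all degrees in G[U] are at least (1 - dl) times the average d, so
   the set H of vertices of degree above (1 + eps/3) d meets few edges.  Deleting
   H and then a few vertices of low degree costs so few edges that, by maximality
   of U, this must stop while most of U is left: one gets a (1 + eps)-nearly
   regular graph on at least |U|/2 vertices.  If G has at least about n^(2 - dl/2)
   edges then |U| is large; otherwise G has a large independent set. *)

Require Import Defs.
From mathcomp Require Import all_boot all_order all_algebra.
From mathcomp Require Import reals exp.
From mathcomp Require sequences.
From mathcomp Require Import lra ring.

Set Implicit Arguments.

Import Order.TTheory GRing.Theory Num.Theory.
Local Open Scope ring_scope.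

(** * Degree sums over vertex sets *)

Section DegreeSums.
Variables (T : finType) (G : sgraph T).
Implicit Types (A B W : {set T}) (v : T).

Definition deg_in A v : nat := #|[set w in A | adj G v w]|.
Definition deg_sum A : nat := \sum_(v in A) deg_in A v.

Lemma adjC v w : adj G v w = adj G w v.
Proof. by have /andP[_ /forallP/(_ v)/forallP/(_ w)/eqP] := adj_simple G. Qed.

Lemma adjxx v : adj G v v = false.
Proof. by have /andP[/forallP/(_ v)/negbTE] := adj_simple G. Qed.

Lemma deg_inE A v : deg_in A v = (\sum_(w in A) adj G v w)%N.
Proof.
rewrite /deg_in -sum1_card big_mkcond [RHS]big_mkcond /=.
by apply: eq_bigr => w _; rewrite inE; case: (w \in A); case: (adj G v w).
Qed.

Lemma deg_inS A B v : A \subset B -> (deg_in A v <= deg_in B v)%N.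
Proof.
move=> /subsetP sAB; apply/subset_leq_card/subsetP => w.
by rewrite !inE => /andP[/sAB -> ->].
Qed.

Lemma deg_sum_le A : (deg_sum A <= #|A| * #|A|)%N.
Proof.
rewrite -sum_nat_const; apply: leq_sum => v _; apply: subset_leq_card.
by apply/subsetP => w; rewrite inE => /andP[].
Qed.

(** Besides the degrees of [B] itself, the sum loses one for each edge between [A :\: B] and [B].
    Counted from the side of [B], these edges number at most the degrees of [B] once more. *)
Lemma deg_sum_setD A B : B \subset A ->
  (deg_sum A <= deg_sum (A :\: B) + 2 * \sum_(v in B) deg_in A v)%N.
Proof.
move=> sBA; rewrite /deg_sum (big_setID B) /= (setIidPr sBA).
rewrite mul2n -addnn addnCA leq_add2l.
have -> : (\sum_(v in A :\: B) deg_in A v = \sum_(v in A :\: B) deg_in (A :\: B) v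
    + \sum_(v in A :\: B) deg_in B v)%N.
  rewrite -big_split /=; apply: eq_bigr => v _; rewrite !deg_inE.
  by rewrite (big_setID B) /= (setIidPr sBA) addnC.
rewrite leq_add2l; under eq_bigr do rewrite deg_inE.
rewrite exchange_big /=; apply: leq_sum => w _.
under eq_bigr do rewrite adjC.
by rewrite -deg_inE; apply/deg_inS/subsetDl.
Qed.

Lemma degree_induced A (x : {x : T | x \in A}) :
  degree (induced G A) x = deg_in A (val x).
Proof.
rewrite /degree /deg_in -(card_imset _ val_inj); apply: eq_card => w.
rewrite [RHS]inE; apply/imsetP/andP => [[y]|[wA h]].
  by rewrite inE !ffunE => h ->; rewrite h (valP y).
by exists (Sub w wA); rewrite ?inE ?ffunE SubK.
Qed.

Lemma induced_nearly_regular (R : realType) (c lo hi : R) A :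
    hi <= c * lo -> 0 <= c ->
    (forall v, v \in A -> lo <= (deg_in A v)%:R <= hi) ->
  nearly_regular c (induced G A).
Proof.
move=> hilo c0 hA; rewrite /nearly_regular.
case: (set_0Vmem A) => [A0|[v0 v0A]].
  rewrite /maxdeg big_pred0; first by rewrite mulr_ge0.
  by move=> [x xA]; move: (xA); rewrite {1}A0 inE.
have le_hi : (maxdeg (induced G A))%:R <= hi.
  rewrite /maxdeg; elim/big_ind: _ => [|m n hm hn|x _].
  - have /andP[_] := hA _ v0A; exact: le_trans.
  - by rewrite /maxn; case: ifP.
  - by rewrite degree_induced; have /andP[] := hA _ (valP x).
have lo_le : lo <= (mindeg (induced G A))%:R.
  rewrite /mindeg; elim/big_ind: _ => [|m n hm hn|x _].
  (* The initial value of [mindeg] is here [#|A|], which bounds the degree of [v0] and hence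
     [lo]. *)
  - have /andP[h _] := hA _ v0A; apply: le_trans h _.
    rewrite card_sig ler_nat; apply: subset_leq_card.
    by apply/subsetP => w; rewrite !inE => /andP[].
  - by rewrite /minn; case: ifP.
  - by rewrite degree_induced; have /andP[] := hA _ (valP x).
by apply: le_trans le_hi (le_trans hilo _); rewrite ler_wpM2l.
Qed.

Lemma leq_f_graph (R : realType) (c : R) A :
  nearly_regular c (induced G A) -> (#|A| <= f_graph G c)%N.
Proof. by move=> hA; rewrite /f_graph (bigD1 A) //= leq_maxl. Qed.

End DegreeSums.

(** * Real inequalities *)

(** Weighted AM-GM for 1 and [t]: apply [ln x <= x - 1] at [1 / A] and [t / A], where [A] is the
    right-hand side. With weights [d] and [1 - d] the upper bounds sum to 0. *)
Lemma powR_le_chord (R : realType) (d t : R) : 0 < d < 1 -> 0 <= t ->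
  t `^ (1 - d) <= d + (1 - d) * t.
Proof.
move=> /andP[d0 d1]; rewrite le_eqVlt => /predU1P[<-|t0].
  by rewrite powR0 ?mulr0 ?addr0 ?ltW //; lra.
set A := d + _; have A0 : 0 < A by rewrite /A; nra.
have lnle (x : R) : 0 < x -> ln x <= x - 1.
  by move=> x0; have := expR_ge1Dx (ln x); rewrite lnK ?posrE //; lra.
rewrite -ler_ln ?posrE ?powR_gt0 // ln_powR.
have h1 := lnle _ (divr_gt0 ltr01 A0).
have h2 := lnle _ (divr_gt0 t0 A0).
rewrite ln_div ?posrE // ln1 in h1; rewrite ln_div ?posrE // in h2.
have e : d * (1 / A) + (1 - d) * (t / A) = 1.
  by rewrite /A; field; rewrite -/A; lra.
nra.
Qed.

(* Here x = |H|, and gS, gH are the degree sums of G[S] and G[U \ H], where S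
   maximizes deg_sum S - 2 (1 - eps/3) d |S| among the subsets of U \ H of size
   at least (1 - eps/3) |U|.  The conclusion says that S can lose one more
   vertex without leaving this family. *)
Lemma interior_margin (R : realFieldType) (eps dl u x d s gS gH : R) :
    0 < eps <= 1 -> eps ^+ 2 = 100 * dl -> 6 <= dl * u -> 0 < d ->
    s <= u -> (1 - eps / 3) * u <= s -> x * (eps / 3) <= dl * u ->
    d * u <= gH + 2 * (d * (x + dl * u)) ->
    gH - 2 * (1 - eps / 3) * d * (u - x) <= gS - 2 * (1 - eps / 3) * d * s ->
    gS * u ^+ 2 <= d * u * (s * (dl * u + (1 - dl) * s)) ->
  (1 - eps / 3) * u <= s - 1.
Proof.
move=> /andP[eps0 eps1] dlE dlu dp su sbig xsmall hH hF hU.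
rewrite leNgt; apply/negP => hs.
have dl0 : 0 < dl by have := exprn_gt0 2 eps0; lra.
have u0 : 0 < u by nra.
pose low := u - 2 * (x + dl * u) + 2 * (1 - eps / 3) * (s - u + x).
have h1 : d * low <= gS by rewrite /low; lra.
have h2 : d * low * u ^+ 2 <= d * u * (s * (dl * u + (1 - dl) * s)).
  by apply: le_trans hU; rewrite ler_wpM2r ?sqr_ge0.
have h3 : low * u <= s * (dl * u + (1 - dl) * s).
  rewrite -(ler_pM2l (mulr_gt0 dp u0)); apply: le_trans h2.
  by rewrite le_eqVlt; apply/orP; left; apply/eqP; ring.
(* [r] counts the vertices of [U] outside [S]; the aim is [eps / 3 * r <= 5 * (dl * u)]. *)
have [r sE] : exists r, s = u - r by exists (u - s); ring.
clear hF hU h1 h2 hH; rewrite /low {low} sE in su sbig hs h3.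
have r0 : 0 <= r by lra.
have h4 : u * (- 2 * (dl * u) + 2 * (eps / 3) * r - 2 * (eps / 3) * x) <=
    u * (dl * u + eps / 3 * r).
  have k1 : dl * u * r <= dl * u * u by rewrite ler_wpM2l //; nra.
  have k2 : r * r <= eps / 3 * u * r by rewrite ler_wpM2r //; lra.
  have k3 : 0 <= dl * r * r by rewrite !mulr_ge0 // ltW.
  lra.
have h5 : eps / 3 * r <= 5 * (dl * u) by rewrite ler_pM2l // in h4; lra.
have h6 : eps / 3 * (eps / 3 * u - 1) <= eps / 3 * r.
  by rewrite ler_wpM2l //; lra.
(* Since 100/9 exceeds 5, [h5] and [h6] give [55 / 9 * (dl * u) <= eps / 3], contradicting
   [6 <= dl * u]. *)
have e7 : eps / 3 * (eps / 3 * u) = 100 / 9 * (dl * u).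
  have -> : eps / 3 * (eps / 3 * u) = eps ^+ 2 / 9 * u by field.
  by rewrite dlE; lra.
lra.
Qed.

(** * A nearly regular subgraph inside a density maximizer *)

(* The last hypothesis is the maximality of U, with (|W|/|U|)^(1 - dl) replaced by
   its upper bound dl + (1 - dl) |W|/|U|. *)
Lemma exists_nearly_regular (R : realType) (T : finType) (G : sgraph T)
    (U : {set T}) (eps dl u g : R) :
    0 < eps -> eps <= 1 -> eps ^+ 2 = 100 * dl ->
    u = #|U|%:R -> g = (deg_sum G U)%:R -> 6 <= dl * u ->
    (forall W : {set T}, W \subset U ->
      (deg_sum G W)%:R * u ^+ 2 <=
      g * (#|W|%:R * (dl * u + (1 - dl) * #|W|%:R))) ->
  exists2 S : {set T}, u / 2 <= #|S|%:R & nearly_regular (1 + eps) (induced G S).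
Proof.
move=> eps0 eps1 dlE uE gE0 dlu Umax.
have eps2 : 0 < eps ^+ 2 by rewrite exprn_gt0.
have dl0 : 0 < dl by lra.
have ule : eps ^+ 2 <= eps by rewrite expr2; nra.
have u0 : 0 < u by nra.
have g0 : 0 <= g by rewrite gE0.
pose d := g / u.
have d0 : 0 <= d by rewrite divr_ge0 // ltW.
have gE : g = d * u by rewrite /d divfK ?gt_eqF.
clearbody d.
have min_deg v : v \in U -> (1 - dl) * d <= (deg_in G U v)%:R.
  move=> vU; have := @deg_sum_setD _ G U [set v]; rewrite sub1set => /(_ vU).
  rewrite big_set1 -(ler_nat R) natrD natrM -gE0 => h1.
  have := Umax _ (subsetDl U [set v]).
  have -> : #|U :\: [set v]|%:R = u - 1.
    by rewrite uE (cardsD1 v U) vU /= natrD addrC addKr.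
  move: h1; rewrite gE.
  set gW := (deg_sum _ _)%:R; set x := (deg_in _ _ _)%:R => h1 h2.
  have h3 : (d * u - 2 * x) * u ^+ 2 <= d * u * ((u - 1) * (u - 1 + dl)).
    apply: le_trans (le_trans h2 _); first by rewrite ler_wpM2r ?sqr_ge0 //; lra.
    by rewrite le_eqVlt; apply/orP; left; apply/eqP; ring.
  (* Deleting [v] gives a degree of about [(1 - dl / 2) * d]; weakening this to [(1 - dl) * d]
     absorbs the lower-order terms, as [dl * u] is at least 6. *)
  have h4 : 0 <= d * u * (dl * u - 1 + dl).
    by rewrite mulr_ge0 ?mulr_ge0 ?(ltW u0) //; lra.
  rewrite -(ler_pM2r (exprn_gt0 2 u0)); nra.
pose H := [set v in U | (1 + eps / 3) * d < (deg_in G U v)%:R].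
have sHU : H \subset U by apply/subsetP => v; rewrite inE => /andP[].
pose x : R := #|H|%:R.
pose DH : R := (\sum_(v in H) deg_in G U v)%:R.
have cardDH : #|U :\: H|%:R = u - x.
  by rewrite uE -(cardsID H U) (setIidPr sHU) natrD -/x addrC addKr.
have sum_rest : (u - x) * ((1 - dl) * d) + DH <= g.
  rewrite gE0 /deg_sum (big_setID H) /= (setIidPr sHU) natrD -/DH addrC lerD2l.
  rewrite natr_sum -cardDH mulr_natl -sumr_const; apply: ler_sum => v.
  by rewrite inE => /andP[_ /min_deg].
have DH_ge : x * ((1 + eps / 3) * d) <= DH.
  rewrite /DH natr_sum mulr_natl -sumr_const; apply: ler_sum => v.
  by rewrite inE => /andP[_ /ltW].
have x0 : 0 <= x by [].
have DH_le : DH <= d * (x + dl * u).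
  have : 0 <= dl * x * d by rewrite !mulr_ge0 // ltW.
  by move: sum_rest; rewrite gE; lra.
have d_cases : d = 0 \/ 0 < d by move: d0; rewrite le_eqVlt => /predU1P[<-|]; auto.
have H_small : x * (eps / 3) <= dl * u.
  case: d_cases => [dz|dp].
    have -> : x = 0; last by rewrite mul0r; lra.
    apply/eqP; rewrite /x pnatr_eq0 cards_eq0 -subset0; apply/subsetP => v.
    rewrite !inE => /andP[vU]; rewrite dz mulr0 ltr0n; apply: contraTT => _.
    have : g = 0 by rewrite gE dz mul0r.
    move/eqP; rewrite gE0 pnatr_eq0 /deg_sum sum_nat_eq0 => /forall_inP/(_ v vU).
    by move/eqP ->.
  by rewrite -(ler_pM2l dp); lra.
have xle : x <= 3 / 100 * eps * u.
  rewrite -(ler_pM2r (_ : 0 < eps / 3)); last by lra.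
  have : dl * u = 3 / 100 * eps * u * (eps / 3) by nra.
  by move <-.
(* Maximizing [F] replaces the successive deletion of low-degree vertices: losing [v] costs at most
   twice its degree in [S] and gains [2 * (1 - eps / 3) * d], so that degree is at least
   [(1 - eps / 3) * d] if [S :\ v] still satisfies [P]. *)
pose F (S : {set T}) : R := (deg_sum G S)%:R - 2 * (1 - eps / 3) * d * #|S|%:R.
pose P (S : {set T}) := (S \subset U :\: H) && ((1 - eps / 3) * u <= #|S|%:R).
have PUH : P (U :\: H) by rewrite /P subxx cardDH; nra.
case: (arg_maxP F PUH) => S /andP[sS Sbig] Smax.
have sSU : S \subset U := subset_trans sS (subsetDl _ _).
have SleU : #|S|%:R <= u by rewrite uE ler_nat subset_leq_card.
have hUH : g <= (deg_sum G (U :\: H))%:R + 2 * DH.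
  by rewrite gE0 /DH -natrM -natrD ler_nat deg_sum_setD.
have S_interior : 0 < d -> (1 - eps / 3) * u <= #|S|%:R - 1.
  move=> dp.
  have hF : (deg_sum G (U :\: H))%:R - 2 * (1 - eps / 3) * d * (u - x) <= F S.
    by have := Smax _ PUH; rewrite /F cardDH.
  have eps01 : 0 < eps <= 1 by rewrite eps0.
  apply: (@interior_margin _ eps dl u x d #|S|%:R _ _ eps01 dlE dlu dp SleU Sbig
    H_small _ hF).
    by move: hUH DH_le; rewrite gE; lra.
  by rewrite -gE; apply: Umax.
exists S; first by nra.
apply: (@induced_nearly_regular _ _ _ _ ((1 - eps / 3) * d) ((1 + eps / 3) * d)).
(* [(1 + eps) * (1 - eps / 3) >= 1 + eps / 3] amounts to [eps <= 1]. *)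
- by nra.
- by lra.
move=> v vS; apply/andP; split; last first.
  have : v \in U :\: H by exact: (subsetP sS).
  rewrite inE => /andP[vH vU]; apply: (@le_trans _ _ (deg_in G U v)%:R).
    by rewrite ler_nat deg_inS.
  by move: vH; rewrite inE vU /= -leNgt.
case: d_cases => [->|dp]; first by rewrite mulr0.
have cardS1 : #|S :\ v|%:R = #|S|%:R - 1 :> R.
  by rewrite (cardsD1 v S) vS /= natrD addrC addKr.
have hm : F (S :\ v) <= F S.
  by apply: Smax; rewrite /P cardS1 S_interior // (subset_trans (subsetDl _ _) sS).
have := @deg_sum_setD _ G S [set v]; rewrite sub1set => /(_ vS).
rewrite big_set1 -(ler_nat R) natrD natrM => hd.
by move: hm; rewrite /F cardS1; lra.
Qed.

(** * Sparse graphs: independent sets *)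

(** By averaging, at least half of the vertices have degree at most [2 * D]. A maximal independent
    set among these dominates them all, and each of its members covers at most [1 + 2 * D <= 3 * D]
    vertices. *)
Lemma large_independent (R : realType) (T : finType) (G : sgraph T) (c D : R) :
    1 <= D -> 0 <= c -> (deg_sum G [set: T])%:R <= #|T|%:R * D ->
  exists2 S : {set T}, #|T|%:R <= 6 * D * #|S|%:R & nearly_regular c (induced G S).
Proof.
move=> D1 c0 gD; have D0 : 0 < D by lra.
pose L := [set v | (deg_in G setT v)%:R <= 2 * D].
have L_large : #|T|%:R <= 2 * #|L|%:R :> R.
  have : #|~: L|%:R * (2 * D) <= #|T|%:R * D.
    apply: le_trans gD; rewrite mulr_natl -sumr_const /deg_sum natr_sum.
    rewrite [leRHS](big_setID (~: L)) /= setTI -[leLHS]addr0.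
    apply: lerD; last exact: sumr_ge0.
    by apply: ler_sum => v; rewrite !inE -ltNge => /ltW.
  have := cardsC L => /(congr1 (fun k => k%:R : R)).
  by rewrite natrD mulrA ler_pM2r // => <-; lra.
pose P (A : {set T}) :=
  (A \subset L) && [forall v in A, forall w in A, ~~ adj G v w].
have P0 : P set0 by rewrite /P sub0set; apply/forall_inP => v; rewrite inE.
have [I /maxsetP[/andP[IL /forall_inP Iind] Imax]] := ex_maxset (ex_intro P _ P0).
have dominated v : v \in L -> (1 <= \sum_(w in I) ((w == v) + adj G w v))%N.
  move=> vL; rewrite lt0n sum_nat_eq0; apply/negP => /forall_inP h.
  have vI : v \notin I.
    by apply/negP => vI; have := h v vI; rewrite eqxx.
  have nadj w : w \in I -> adj G w v = false.
    by move=> /h; rewrite addn_eq0 !eqb0 => /andP[_ /negbTE].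
  have PvI : P (v |: I).
    rewrite /P subUset sub1set vL IL /=; apply/forall_inP => a.
    rewrite !inE => /predU1P[->|aI]; apply/forall_inP => b;
      rewrite !inE => /predU1P[->|bI].
    - by rewrite adjxx.
    - by rewrite adjC nadj.
    - by rewrite nadj.
    - exact: (forall_inP (Iind _ aI)).
  by have := Imax _ PvI (subsetUr _ _); move: vI => /[swap] <-; rewrite setU11.
have L_small : #|L|%:R <= #|I|%:R * (3 * D).
  have h1 : (#|L| <= \sum_(w in I) (1 + deg_in G setT w))%N.
    rewrite -sum1_card.
    apply: leq_trans (_ : _ <= \sum_(v in L) \sum_(w in I) ((w == v) + adj G w v))%N _.
      exact: leq_sum.
    rewrite exchange_big /=; apply: leq_sum => w _; rewrite big_split /=.
    apply: leq_add.
      rewrite -[leqRHS](cards1 w) -sum1_card big_mkcond [leqRHS]big_mkcond.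
      by apply: leq_sum => v _; rewrite inE eq_sym; case: (v \in L); case: eqP.
    by rewrite -deg_inE; apply/deg_inS/subsetT.
  apply: (@le_trans _ _ (\sum_(w in I) (1 + deg_in G setT w))%:R).
    by rewrite ler_nat.
  rewrite natr_sum mulr_natl -sumr_const; apply: ler_sum => w /(subsetP IL).
  by rewrite inE natrD; lra.
exists I; first by lra.
apply: (@induced_nearly_regular _ _ _ _ 0 0); rewrite ?mulr0 // => v vI.
suff -> : deg_in G I v = 0%N by rewrite lexx.
apply/eqP; rewrite /deg_in cards_eq0 -subset0; apply/subsetP => w.
by rewrite !inE => /andP[wI]; have /forall_inP/(_ w wI)/negbTE -> := Iind v vI.
Qed.

(** * Dense graphs: choice of the maximizer *)

Lemma density_maximizer (R : realType) (T : finType) (G : sgraph T) (dl : R) :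
    0 < dl < 1 -> (0 < #|T|)%N ->
  exists U : {set T}, [/\ (0 < #|U|)%N,
    (deg_sum G [set: T])%:R * #|U|%:R `^ (2 - dl) <=
      (deg_sum G U)%:R * #|T|%:R `^ (2 - dl) &
    forall W : {set T}, (deg_sum G W)%:R * #|U|%:R ^+ 2 <=
      (deg_sum G U)%:R * (#|W|%:R * (dl * #|U|%:R + (1 - dl) * #|W|%:R))].
Proof.
move=> dl01 T0; have /andP[dl0 dl1] := dl01.
pose phi (W : {set T}) : R := (deg_sum G W)%:R / #|W|%:R `^ (2 - dl).
pose P (W : {set T}) := (0 < #|W|)%N.
have PT : P [set: T] by rewrite /P cardsT.
case: (arg_maxP phi PT) => U U0 Umax.
have pow0 (W : {set T}) : (0 < #|W|)%N -> 0 < #|W|%:R `^ (2 - dl) :> R.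
  by move=> W0; rewrite powR_gt0 // ltr0n.
have cross (W : {set T}) : (0 < #|W|)%N -> (deg_sum G W)%:R * #|U|%:R `^ (2 - dl) <=
    (deg_sum G U)%:R * #|W|%:R `^ (2 - dl).
  move=> W0; have : phi W <= phi U by exact: Umax.
  by rewrite /phi ler_pdivrMr ?pow0 // mulrAC ler_pdivlMr ?pow0.
exists U; split => // [|W]; first by have := cross _ PT; rewrite cardsT.
(* The maximum runs over nonempty sets only; for empty [W] both sides vanish. *)
have [W0|W0] := posnP #|W|.
  have -> : deg_sum G W = 0%N.
    by apply/eqP; rewrite -leqn0; apply: leq_trans (deg_sum_le _ _) _; rewrite W0.
  by rewrite W0 !(mul0r, mulr0).
have u0 : 0 < #|U|%:R :> R by rewrite ltr0n.
have w0 : 0 < #|W|%:R :> R by rewrite ltr0n.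
have := cross W W0; move: #|U|%:R #|W|%:R u0 w0 => u w u0 w0 h.
pose t := w / u; have t0 : 0 < t by rewrite divr_gt0.
have wE : w = t * u by rewrite /t divfK ?gt_eqF.
rewrite wE (powRM _ (ltW t0) (ltW u0)) mulrA ler_pM2r ?powR_gt0 // in h.
have ch := @powR_le_chord R dl t dl01 (ltW t0).
have tE : t `^ (2 - dl) = t * t `^ (1 - dl).
  by rewrite -{2}(powRr1 (ltW t0)) -powRD ?(gt_eqF t0) ?implybT //; congr powR; ring.
have h2 : (deg_sum G W)%:R <= (deg_sum G U)%:R * (t * (dl + (1 - dl) * t)).
  by apply: (le_trans h); rewrite ler_wpM2l // tE ler_pM2l.
have : (deg_sum G W)%:R * u ^+ 2 <=
    (deg_sum G U)%:R * (t * (dl + (1 - dl) * t)) * u ^+ 2.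
  by rewrite ler_wpM2r ?sqr_ge0.
by move/le_trans; apply; rewrite wE le_eqVlt; apply/orP; left; apply/eqP; ring.
Qed.

(** * Choice of constants and the two density cases *)

Theorem theorem1p3 (R : realType) :
  exists2 eps0 : R, 0 < eps0 &
    forall eps : R, 0 < eps -> eps <= eps0 ->
    exists n0 : nat, forall n : nat, (n0 <= n)%N ->
      (n%:R : R) `^ (eps ^+ 2 / (250 * ln (1 / eps))) <= (f_num n (1 + eps))%:R.
Proof.
(* This choice gives [ln (1 / eps) >= 1], so the target exponent is at most [eps ^+ 2 / 250]. *)
exists (sequences.expR (-1)) => [|eps eps0 eps_le]; first exact: expR_gt0.
have ln_ge1 : 1 <= ln (1 / eps).
  rewrite ln_div ?posrE // ln1; have : ln eps <= ln (sequences.expR (-1)).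
    by rewrite ler_ln ?posrE ?expR_gt0.
  by rewrite expRK; lra.
have eps1 : eps <= 1.
  by apply: le_trans eps_le _; rewrite -[leRHS]expR0 ler_expR; lra.
have esq0 : 0 < eps ^+ 2 by rewrite exprn_gt0.
have esq1 : eps ^+ 2 <= 1 by rewrite exprn_ile1 // ltW.
(* With [Q] the power [kap] of [n], all exponents become integers: [Q ^+ 4] bounds the target, and
   [Q ^+ 10] is the power [dl] of [n]. As [K] is [6 / dl], [Q >= K] yields both [6 <= dl * #|U|] and
   the factor 6 in [Q54]. *)
pose kap : R := eps ^+ 2 / 1000; have kap0 : 0 < kap by rewrite divr_gt0.
pose K : R := 600 / eps ^+ 2; have K0 : 0 < K by rewrite divr_gt0.
have K600 : 600 <= K by rewrite /K ler_pdivlMr //; lra.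
exists (Num.bound (K `^ kap^-1)) => n n0n.
have Kn : K `^ kap^-1 <= n%:R.
  apply: le_trans (ltW (archi_boundP (powR_ge0 _ _))) _; by rewrite ler_nat.
have N0 : 0 < n%:R :> R by apply: lt_le_trans Kn; rewrite powR_gt0.
have N1 : 1 <= n%:R :> R by rewrite ler1n -(ltr0n R).
pose Q : R := n%:R `^ kap.
have QK : K <= Q.
  have := @ge0_ler_powR R kap (ltW kap0) (K `^ kap^-1) n%:R.
  rewrite !nnegrE powR_ge0 ler0n => /(_ isT isT Kn).
  by rewrite -powRrM mulVf ?gt_eqF // powRr1 // ltW.
have Q1 : 1 <= Q by lra.
have Q0 : 0 < Q by lra.
have QX m : Q ^+ m = n%:R `^ (kap * m%:R).
  by rewrite powRrM powR_mulrn // powR_ge0.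
have [[G ->] _] := f_numP n (1 + eps).
suff [S SQ Sreg] : exists2 S : {set 'I_n}, Q ^+ 4 <= #|S|%:R &
    nearly_regular (1 + eps) (induced G S).
  have h : (#|S|%:R : R) <= (f_graph G (1 + eps))%:R by rewrite ler_nat leq_f_graph.
  apply: le_trans (le_trans SQ h); rewrite QX ler_powR //.
  have -> : kap * 4 = eps ^+ 2 / 250 by rewrite /kap; field.
  by rewrite ler_pM2l // lef_pV2 ?posrE; lra.
pose dl : R := eps ^+ 2 / 100; have dl0 : 0 < dl by rewrite divr_gt0.
have dl01 : 0 < dl < 1 by rewrite dl0 /=; rewrite /dl; lra.
have Q54 : 6 * Q ^+ 4 <= Q ^+ 5 by rewrite [Q ^+ 5]exprS ler_wpM2r ?exprn_ge0 //; lra.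
have [dense|sparse] := lerP (n%:R ^+ 2) ((deg_sum G setT)%:R * Q ^+ 5).
  have n0 : (0 < #|'I_n|)%N by rewrite card_ord -(ltr0n R).
  have [U [U0 UT UW]] := @density_maximizer R _ G dl dl01 n0.
  have u0 : 0 < #|U|%:R :> R by rewrite ltr0n.
  have Nsplit : n%:R ^+ 2 = n%:R `^ (2 - dl) * Q ^+ 10.
    rewrite QX -powRD ?(gt_eqF N0) ?implybT // -powR_mulrn //; congr powR.
    by rewrite /dl /kap; field.
  have usplit : #|U|%:R ^+ 2 = #|U|%:R `^ (2 - dl) * #|U|%:R `^ dl :> R.
    rewrite -powRD ?(gt_eqF u0) ?implybT // -powR_mulrn //; congr powR; ring.
  (* Bounding the degree sum of [U] by its size squared, maximality against the whole graph gives
     [deg_sum G setT] at most [#|U|] to the [dl] times [n] to the [2 - dl]; density then forces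
     [Q ^+ 5] below the first factor. *)
  have Qu : Q ^+ 5 <= #|U|%:R.
    apply: le_trans (ler1_powR _ _ : #|U|%:R `^ dl <= _); last 2 first.
    - by rewrite ler1n.
    - by case/andP: dl01 => _ /ltW.
    have gu : (deg_sum G U)%:R <= #|U|%:R ^+ 2 :> R.
      by rewrite -natrX ler_nat -mulnn deg_sum_le.
    rewrite card_ord in UT.
    have Nd0 : 0 < n%:R `^ (2 - dl) :> R by rewrite powR_gt0.
    have ud0 : 0 < #|U|%:R `^ (2 - dl) :> R by rewrite powR_gt0.
    have Q50 : 0 < Q ^+ 5 by rewrite exprn_gt0.
    have c1 : (deg_sum G setT)%:R <= #|U|%:R `^ dl * n%:R `^ (2 - dl).
      rewrite -(ler_pM2r ud0); apply: le_trans UT _.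
      have := ler_wpM2r (ltW Nd0) gu; rewrite usplit => /le_trans; apply.
      by rewrite le_eqVlt; apply/orP; left; apply/eqP; ring.
    have Q10 : Q ^+ 10 = Q ^+ 5 * Q ^+ 5 by rewrite -exprD.
    rewrite Nsplit Q10 mulrA ler_pM2r // in dense.
    by rewrite -(ler_pM2l Nd0); apply: le_trans dense _; rewrite mulrC.
  have [|||||||S Su Sreg] := @exists_nearly_regular _ _ G U eps dl #|U|%:R
    (deg_sum G U)%:R => //.
  - by rewrite /dl; field.
  - have -> : 6 = dl * K by rewrite /dl /K; field; rewrite gt_eqF.
    rewrite ler_pM2l //; apply: le_trans QK (le_trans _ Qu).
    by rewrite -[leLHS]expr1 ler_weXn2l.
  exists S => //; lra.
have Q5N : Q ^+ 5 <= n%:R.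
  by rewrite QX ler1_powR // /kap; lra.
have Q50 : 0 < Q ^+ 5 by rewrite exprn_gt0.
(* For this [D] the lemma gives [Q ^+ 5 <= 6 * #|S|], and [Q54] absorbs the 6. *)
have [|||S Sn Sreg] := @large_independent R _ G (1 + eps) (n%:R / Q ^+ 5).
- by rewrite ler_pdivlMr // mul1r.
- lra.
- by rewrite card_ord mulrA ler_pdivlMr // -expr2 ltW.
exists S => //; rewrite card_ord in Sn.
have : n%:R * Q ^+ 5 <= n%:R * (6 * #|S|%:R).
  have -> : n%:R * (6 * #|S|%:R) = 6 * (n%:R / Q ^+ 5) * #|S|%:R * Q ^+ 5.
    by field; rewrite gt_eqF.
  by rewrite ler_pM2r.
by rewrite ler_pM2l //; lra.
Qed.
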